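(* Let $(G,\|\cdot\|)$ be a complete normed linear space and let $R:G\to G$ be an enriched interpolative Matkowski mapping. Then: (1) $R$ has a fixed point, denoted $s$. (2) For any given initial point $p_0\in G$ there exists a real number $\lambda\in(0,1]$ such that the iterative scheme $\{p_m\}_{m=0}^\infty$ defined by $$p_{m+1}=(1-\lambda)p_m+\lambda Rp_m,\qquad m\ge 0,$$ converges to $s$.
   Context: $\mathrm{Z}$ denotes the collection of functions $\zeta:[0,\infty)\to[0,\infty)$ such that $\zeta$ is non-decreasing and $\lim_{n\to\infty}\zeta^n(t)=0$ for all $t>0$, where $\zeta^n$ is the $n$-th iterate of $\zeta$. $\mathrm{Fix}(R)=\{p\in G: Rp=p\}$. A self-mapping $R:G\to G$ of a complete normed linear space $(G,\|\cdot\|)$ is called an enriched interpolative Matkowski mapping if there exist $a,b,c\in(0,1)$ with $a+b+c<1$, $k\in[0,+\infty)$ and $\zeta\in\mathrm{Z}$ such that for all $p,q\in G\setminus\mathrm{Fix}(R)$ $$\|k(p-q)+Rp-Rq\|\le \zeta\Big[\|(k+1)(p-q)\|^b\,\|p-Rp\|^a\,\|q-Rq\|^c\Big(\tfrac12\big(\|(k+1)(p-q)+q-Rq\|+\|(k+1)(q-p)+p-Rp\|\big)\Big)^{1-a-b-c}\Big].$$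
   Formalization: In (2) the scheme converges to a fixed point s of R that may depend on the initial point p_0; a single s for all p_0 is impossible, e.g. for R the identity on a nonzero space, which satisfies the condition vacuously. *)

(* Defs.v *)
From HB Require Import structures.
From mathcomp Require Import all_boot all_order all_algebra.
From mathcomp Require Import all_classical all_reals all_analysis.

Set Implicit Arguments.
Unset Strict Implicit.
Unset Printing Implicit Defensive.

Import Order.TTheory GRing.Theory Num.Theory.
Import numFieldNormedType.Exports.

Local Open Scope classical_set_scope.
Local Open Scope ring_scope.

(* The class Z of non-decreasing self-maps of [0, +oo[ whose iterates tend to 0
   pointwise. Such a map is represented by a function on K that preserves
   [0, +oo[; its values at negative arguments are irrelevant. *)
Definition Zclass (K : realType) (zeta : K -> K) : Prop :=
  [/\ forall t, 0 <= t -> 0 <= zeta t,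
      forall t u, 0 <= t -> t <= u -> zeta t <= zeta u
    & forall t, 0 < t -> iter n zeta t @[n --> \oo] --> (0 : K)].

Definition Fix (T : Type) (R : T -> T) : set T := [set p | R p = p].

(* All the bases of the real powers are non-negative and all the exponents are
   positive, so the convention 0 `^ 0 = 1 plays no role. *)
Definition enriched_interpolative_Matkowski (K : realType)
    (G : completeNormedModType K) (R : G -> G) : Prop :=
  exists (a b c k : K) (zeta : K -> K),
  [/\ [/\ 0 < a < 1, 0 < b < 1, 0 < c < 1 & a + b + c < 1],
      0 <= k,
      Zclass zeta
    & forall p q : G, (~` Fix R) p -> (~` Fix R) q ->
      `|k *: (p - q) + R p - R q| <=
      zeta (`|(k + 1) *: (p - q)| `^ b * `|p - R p| `^ a * `|q - R q| `^ c *
            (2^-1 * (`|(k + 1) *: (p - q) + q - R q| +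
                     `|(k + 1) *: (q - p) + p - R p|)) `^ (1 - a - b - c))].

Definition averaged (K : realType) (G : completeNormedModType K)
  (lambda : K) (R : G -> G) (p : G) : G := (1 - lambda) *: p + lambda *: R p.

(* Main.v *)
Require Import Defs.
From HB Require Import structures.
From mathcomp Require Import all_boot all_order all_algebra.
From mathcomp Require Import all_classical all_reals all_analysis.
From mathcomp Require Import ring lra.
Import Order.TTheory GRing.Theory Num.Theory.
Import numFieldNormedType.Exports.
Local Open Scope classical_set_scope.
Local Open Scope ring_scope.

(* With lambda = 1/(k+1) and E = (k+1) `|. - .|, the hypothesis on R says that
   T = (1 - lambda) id + lambda R satisfies
     E (Tp) (Tq) <= zeta (E(p,q)^b E(p,Tp)^a E(q,Tq)^c
                          ((E(p,Tq) + E(q,Tp))/2)^(1-a-b-c)),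
   and R and T have the same fixed points. Along an orbit of T that never hits
   a fixed point, the gaps E(x_n,x_{n+1}) are dominated by the zeta-iterates of
   the first gap, hence tend to 0. If E(p,q) <= t, E(q,Tq) <= t and E(p,Tp) is
   at most a small fixed multiple of t, then the bound gives E(Tp,Tq) < t/2;
   with p = x_N, q = x_m this traps the orbit in a ball of radius t around x_N,
   so the orbit is Cauchy, and with q its limit and t = E(q,Tq) it
   shows that a non-fixed limit is impossible. *)

(** If [t <= zeta t], monotonicity keeps every iterate of [zeta] at [t] above [t], so the iterates
    cannot tend to 0. *)
Lemma Zclass_lt {K : realType} {zeta : K -> K} (hz : Zclass zeta) (t : K) :
  0 < t -> zeta t < t.
Proof.
move=> t0; case: hz => _ hm hl; rewrite ltNge; apply/negP => tz.
have hn n : t <= iter n zeta t.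
  elim: n => [|n IH] //=; exact: le_trans tz (hm _ _ (ltW t0) IH).
have : t <= 0.
  rewrite -(cvg_lim (@Rhausdorff K) (hl t t0)).
  apply: limr_ge; first by apply: cvgP (hl t t0).
  by apply: nearW.
by rewrite leNgt t0.
Qed.

(** The factor [M] stays inside the distance because [zeta] is not homogeneous, so [k + 1] cannot be
    divided out of the contraction inequality. *)
Definition scaled_dist {K : realType} {G : normedModType K} (M : K) (p q : G) : K :=
  M * `|p - q|.

Definition interpolative_contraction {K : realType} {G : normedModType K}
    (E : G -> G -> K) (T : G -> G) (a b c : K) (zeta : K -> K) : Prop :=
  forall p q : G, T p <> p -> T q <> q ->
  E (T p) (T q) <= zeta (E p q `^ b * E p (T p) `^ a * E q (T q) `^ c *
    (2^-1 * (E p (T q) + E q (T p))) `^ (1 - a - b - c)).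

Lemma scaled_dist_ge0 {K : realType} {G : normedModType K} (M : K) (p q : G) :
  0 <= M -> 0 <= scaled_dist M p q.
Proof. by move=> M0; rewrite mulr_ge0. Qed.

Lemma scaled_distC {K : realType} {G : normedModType K} (M : K) (p q : G) :
  scaled_dist M p q = scaled_dist M q p.
Proof. by rewrite /scaled_dist distrC. Qed.

Lemma scaled_dist_triangle {K : realType} {G : normedModType K} (M : K) (q p r : G) :
  0 <= M -> scaled_dist M p r <= scaled_dist M p q + scaled_dist M q r.
Proof. by move=> M0; rewrite /scaled_dist -mulrDr ler_wpM2l// ler_distD. Qed.

Lemma scaled_dist_gt0 {K : realType} {G : normedModType K} (M : K) (p q : G) :
  0 < M -> q <> p -> 0 < scaled_dist M p q.
Proof.
move=> M0 qp; rewrite mulr_gt0// normr_gt0 subr_eq0.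
by apply/eqP => pq; apply: qp.
Qed.

(** Powers with non-negative exponent are monotone in the base, and the four exponents sum to 1, so
    [t] comes out to the first power. The exponent of [kappa] is below 1 and [1 <= kappa], so that
    power is at most [kappa]. *)
Lemma interpolative_prod_le {K : realType} {a b c t eta kappa x y z w : K} :
  0 < a -> 0 < b -> 0 < c -> a + b + c < 1 -> 0 < t ->
  0 <= eta -> 1 <= kappa ->
  0 <= x <= t -> 0 <= y <= eta * t -> 0 <= z <= t -> 0 <= w <= kappa * t ->
  x `^ b * y `^ a * z `^ c * w `^ (1 - a - b - c) <= kappa * eta `^ a * t.
Proof.
move=> a0 b0 c0 abc t0 e0 k1 /andP[x0 xt] /andP[y0 yt] /andP[z0 zt] /andP[w0 wt].
have k0 : 0 <= kappa by lra.
have e'0 : 0 < 1 - a - b - c by lra.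
apply: (@le_trans _ _ (t `^ b * (eta * t) `^ a * t `^ c * (kappa * t) `^ (1 - a - b - c))).
  have pw u v r : 0 <= u -> u <= v -> 0 <= r -> u `^ r <= v `^ r.
    by move=> u0 uv r0; apply: ge0_ler_powR; rewrite // nnegrE// (le_trans u0).
  by do ![apply: ler_pM; rewrite ?mulr_ge0 ?powR_ge0//]; apply: pw => //; apply: ltW.
rewrite !powRM ?(ltW t0)//.
have -> : t `^ b * (eta `^ a * t `^ a) * t `^ c *
    (kappa `^ (1 - a - b - c) * t `^ (1 - a - b - c)) =
    kappa `^ (1 - a - b - c) * eta `^ a *
    (t `^ b * t `^ a * t `^ c * t `^ (1 - a - b - c)) by ring.
rewrite -!powRD ?(gt_eqF t0) ?implybT//.
have -> : b + a + c + (1 - a - b - c) = 1 by ring.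
rewrite powRr1 ?(ltW t0)// ler_pM2r// ler_wpM2r ?powR_ge0//.
rewrite -[leRHS]powRr1 ?ler_powR//; lra.
Qed.

(* The factor [E p (T p) `^ a] beats the factor at most [2] coming from the
   last base as soon as [eta `^ a <= 1/4]. *)
Lemma interpolative_half {K : realType} {G : normedModType K} {M : K}
    {T : G -> G} {a b c : K} {zeta : K -> K} :
  0 <= M -> 0 < a < 1 -> 0 < b -> 0 < c -> a + b + c < 1 -> Zclass zeta ->
  interpolative_contraction (scaled_dist M) T a b c zeta ->
  exists eta : K, 0 < eta <= 4^-1 /\
    forall (p q : G) (t : K), T p <> p -> T q <> q -> 0 < t ->
    scaled_dist M p q <= t -> scaled_dist M p (T p) <= eta * t ->
    scaled_dist M q (T q) <= t -> scaled_dist M (T p) (T q) < t / 2.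
Proof.
move=> M0 /andP[a0 a1] b0 c0 abc hz hT.
set E := scaled_dist M in hT *.
have E0 p q : 0 <= E p q by exact: scaled_dist_ge0.
have eta4 : 4^-1 `^ a^-1 <= 4^-1 :> K.
  have -> : 4^-1 `^ a^-1 = (4 `^ a^-1)^-1 :> K.
    apply: (@mulfI _ (4 `^ a^-1)); first by rewrite gt_eqF// powR_gt0.
    by rewrite -powRM// !divff ?powR1// gt_eqF// powR_gt0.
  rewrite lef_pV2 ?posrE ?powR_gt0//.
  rewrite -[leLHS]powRr1//; apply: ler_powR; first by lra.
  by rewrite -[leLHS]invr1 lef_pV2 ?posrE// ltW.
exists (4^-1 `^ a^-1); split; first by rewrite eta4 powR_gt0.
move=> p q t hp hq t0 pq pT qT.
have t20 : 0 < t / 2 by lra.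
(* Strictness comes from [zeta (t / 2) < t / 2], so it suffices to bound the argument of [zeta] by
   [2 * (1/4) * t = t / 2]. *)
apply: le_lt_trans (hT p q hp hq) _; apply: le_lt_trans (Zclass_lt hz _ t20).
have [_ hm _] := hz; apply: hm; first by rewrite !mulr_ge0 ?powR_ge0.
have w2 : 2^-1 * (E p (T q) + E q (T p)) <= 2 * t.
  have h1 : E p (T q) <= E p q + E q (T q) by exact: scaled_dist_triangle.
  have h2 : E q (T p) <= E p q + E p (T p).
    by rewrite /E (scaled_distC M p q); exact: scaled_dist_triangle.
  have : 4^-1 `^ a^-1 * t <= 4^-1 * t by rewrite ler_pM2r.
  lra.
apply: le_trans (interpolative_prod_le (t := t) (eta := 4^-1 `^ a^-1)
  (kappa := 2) a0 b0 c0 abc t0 _ _ _ _ _ _) _.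
- by rewrite powR_ge0.
- by rewrite ler1n.
- by rewrite E0.
- by rewrite E0.
- by rewrite E0.
- by rewrite w2 mulr_ge0 ?addr_ge0 ?invr_ge0.
rewrite -powRrM mulVf ?gt_eqF// powRr1 ?invr_ge0//; lra.
Qed.

(** Let [t] be the larger of the two consecutive gaps. All four bases are at most [t], the last
    because [E (T p) (T p) = 0], so the new gap is at most [zeta t < t]. Hence the maximum is the
    old gap. *)
Lemma interpolative_step {K : realType} {G : normedModType K} {M : K}
    {T : G -> G} {a b c : K} {zeta : K -> K} (p : G) :
  0 < M -> 0 < a -> 0 < b -> 0 < c -> a + b + c < 1 -> Zclass zeta ->
  interpolative_contraction (scaled_dist M) T a b c zeta ->
  T p <> p -> T (T p) <> T p ->
  scaled_dist M (T p) (T (T p)) <= zeta (scaled_dist M p (T p)).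
Proof.
move=> M0 a0 b0 c0 abc hz hT hp hTp.
set E := scaled_dist M in hT *.
have E0 q r : 0 <= E q r by exact/scaled_dist_ge0/ltW.
have Etri : E p (T (T p)) <= E p (T p) + E (T p) (T (T p)).
  exact/scaled_dist_triangle/ltW.
have Ett : E (T p) (T p) = 0 by rewrite /E /scaled_dist subrr normr0 mulr0.
set t := Num.max (E p (T p)) (E (T p) (T (T p))).
have xt : E p (T p) <= t by rewrite le_max lexx.
have yt : E (T p) (T (T p)) <= t by rewrite le_max lexx orbT.
have t0 : 0 < t.
  by apply: lt_le_trans xt; apply: scaled_dist_gt0.
have step : E (T p) (T (T p)) <= zeta t.
  apply: le_trans (hT _ _ hp hTp) _.
  have [_ hm _] := hz; apply: hm; first by rewrite !mulr_ge0 ?powR_ge0.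
  have -> : t = 1 * 1 `^ a * t by rewrite powR1 !mul1r.
  apply: interpolative_prod_le => //; rewrite ?mul1r ?E0//.
  by rewrite mulr_ge0 ?addr_ge0 ?invr_ge0//= Ett; lra.
have [le_yx|lt_xy] := leP (E (T p) (T (T p))) (E p (T p)).
  by move: step; rewrite /t max_l.
have t_y : t = E (T p) (T (T p)) by rewrite /t max_r // ltW.
by have := Zclass_lt hz _ t0; rewrite ltNge {1}t_y step.
Qed.

Lemma interpolative_gap_cvg0 {K : realType} {G : normedModType K} {M : K}
    {T : G -> G} {a b c : K} {zeta : K -> K} (p : G) :
  0 < M -> 0 < a -> 0 < b -> 0 < c -> a + b + c < 1 -> Zclass zeta ->
  interpolative_contraction (scaled_dist M) T a b c zeta ->
  (forall n, T (iter n T p) <> iter n T p) ->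
  scaled_dist M (iter n T p) (iter n.+1 T p) @[n --> \oo] --> (0 : K).
Proof.
move=> M0 a0 b0 c0 abc hz hT hp.
have [_ hm hl] := hz.
have d0 : 0 < scaled_dist M p (T p) by exact: scaled_dist_gt0 (hp 0).
have dn n : scaled_dist M (iter n T p) (iter n.+1 T p) <=
    iter n zeta (scaled_dist M p (T p)).
  elim: n => [//|n IH]; rewrite [leRHS]/=.
  apply: le_trans (interpolative_step (iter n T p) M0 a0 b0 c0 abc hz hT (hp n) (hp n.+1)) _.
  by apply: hm => //; exact/scaled_dist_ge0/ltW.
apply: (squeeze_cvgr _ (cvg_cst 0) (hl _ d0)).
by apply: nearW => n; rewrite dn andbT; exact/scaled_dist_ge0/ltW.
Qed.

Lemma interpolative_orbit_cvg {K : realType} {G : completeNormedModType K} {M : K}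
    {T : G -> G} {a b c : K} {zeta : K -> K} (p : G) :
  1 <= M -> 0 < a < 1 -> 0 < b -> 0 < c -> a + b + c < 1 -> Zclass zeta ->
  interpolative_contraction (scaled_dist M) T a b c zeta ->
  exists s : G, T s = s /\ iter n T p @[n --> \oo] --> s.
Proof.
move=> M1 a01 b0 c0 abc hz hT.
have M0 : 0 < M by lra.
(* The contraction speaks only of non-fixed points; an orbit that hits a fixed point is eventually
   constant. *)
have [[N fixN]|nofix] := pselect (exists n, T (iter n T p) = iter n T p).
  exists (iter N T p); split => //.
  apply: cvg_near_cst; exists N => // m /= /subnK <-.
  by rewrite iterD iter_fix.
have {nofix} hp n : T (iter n T p) <> iter n T p.
  by move=> pn; apply: nofix; exists n.
have [a0 _] := andP a01.
have [eta [/andP[eta0 eta4] half]] := interpolative_half (ltW M0) a01 b0 c0 abc hz hT.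
have gap := interpolative_gap_cvg0 p M0 a0 b0 c0 abc hz hT hp.
set E := scaled_dist M in hT half gap.
have Etri q r s : E r s <= E r q + E q s by exact/scaled_dist_triangle/ltW.
have gap_small e : 0 < e -> \forall n \near \oo, E (iter n T p) (iter n.+1 T p) <= e.
  move=> e0; move/cvgr0Pnorm_lt : gap => /(_ e e0); apply: filterS => n.
  by rewrite ger0_norm ?scaled_dist_ge0 ?(ltW M0)//; exact: ltW.
have cauchy_orbit : cauchy (iter n T p @[n --> \oo]).
  apply: cauchy_exP => e e0.
  have [N _ gapN] := gap_small _ (mulr_gt0 eta0 e0).
  exists (iter N T p); exists N => // m /= Nm.
  rewrite -ball_normE /=.
  (* As [1 <= M], the norm distance is at most [E]. *)
  suff EN : E (iter N T p) (iter m T p) < e.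
    by apply: le_lt_trans EN; rewrite /E /scaled_dist ler_peMl.
  have eta_e : eta * e <= 4^-1 * e by rewrite ler_pM2r.
  (* Induction: [half] puts [x_(j+1+N)] within [e/2] of [x_(N+1)], which is within [eta * e <= e/4]
     of [x_N]. *)
  rewrite -(subnK Nm); elim: (m - N)%N => [|j IH].
    by rewrite /E /scaled_dist subrr normr0 mulr0.
  have := half _ _ e (hp N) (hp (j + N)%N) e0 (ltW IH) (gapN N (leqnn N)).
  have gapj := gapN (j + N)%N (leq_addl j N).
  move=> /(_ (le_trans gapj _)) => /(_ ltac:(lra)) halfj.
  have := Etri (iter N.+1 T p) (iter N T p) (iter (j.+1 + N) T p).
  have := gapN N (leqnn N); rewrite /= in halfj *; lra.
have /cvg_ex[s xs] : cvg (iter n T p @[n --> \oo]) by exact: cauchy_cvg.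
exists s; split => //; apply: contrapT => sT.
set L := E s (T s).
have L0 : 0 < L by exact: scaled_dist_gt0.
have etaL0 : 0 < eta * L by exact: mulr_gt0.
have near_s : \forall n \near \oo, E (iter n T p) s <= eta * L.
  move/cvgrPdistC_lt : xs => /(_ (eta * L / M) (divr_gt0 etaL0 M0)).
  by apply: filterS => n; rewrite ltr_pdivlMr// mulrC; exact: ltW.
have near_s' : \forall n \near \oo, E (iter n.+1 T p) s <= eta * L.
  have [N _ sN] := near_s; exists N => // n /= Nn; apply: (sN n.+1); exact: leqW.
have [n [[gapn sn] sn']] : exists n, (E (iter n T p) (iter n.+1 T p) <= eta * L /\
    E (iter n T p) s <= eta * L) /\ E (iter n.+1 T p) s <= eta * L.
  apply: (@filter_ex _ \oo).
  near=> n; split; [split|]; near: n; [exact: gap_small|exact: near_s|exact: near_s'].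
(* For such [n], [half] gives [E x_(n+1) (T s) < L/2], while [E s x_(n+1) <= L/4]; the triangle
   inequality then yields [L < 3L/4], absurd. *)
have etaL : eta * L <= 4^-1 * L by rewrite ler_pM2r.
have := half _ _ L (hp n) sT L0 _ gapn (lexx L) => /(_ ltac:(lra)) /= halfn.
have := Etri (iter n.+1 T p) s (T s); rewrite -/L (_ : E s _ = E (iter n.+1 T p) s).
  rewrite /= in sn' *; lra.
by rewrite /E scaled_distC.
Unshelve. all: by end_near.
Qed.

Lemma averaged_fixE {K : realType} {G : completeNormedModType K} (R : G -> G)
    (lambda : K) (p : G) :
  lambda != 0 -> averaged lambda R p = p <-> Fix R p.
Proof.
move=> l0; have -> : averaged lambda R p = p + lambda *: (R p - p).
  by rewrite /averaged scalerBl scale1r scalerBr addrA addrAC.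
split=> [/eqP|/= ->]; last by rewrite subrr scaler0 addr0.
by rewrite -subr_eq0 addrAC subrr add0r scaler_eq0 (negbTE l0) subr_eq0 => /eqP.
Qed.

Theorem theorem2 (K : realType) (G : completeNormedModType K) (R : G -> G)
    (hR : enriched_interpolative_Matkowski R) :
  (exists s : G, Fix R s) /\
  (forall p0 : G, exists lambda : K, 0 < lambda <= 1 /\
     exists s : G, Fix R s /\
       iter m (averaged lambda R) p0 @[m --> \oo] --> s).
Proof.
have [a [b [c [k [zeta [[a01 /andP[b0 _] /andP[c0 _] abc] k0 hz hT]]]]]] := hR.
have M0 : 0 < k + 1 by lra.
have Mn0 : k + 1 != 0 by rewrite gt_eqF.
pose T := averaged (k + 1)^-1 R.
(* This identity turns each norm in the hypothesis on [R] into a scaled distance between points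
   among [p], [q], [T p], [T q]. *)
have MT p : (k + 1) *: T p = (k + 1) *: p - (p - R p).
  rewrite /T /averaged scalerDr !scalerA mulrBr mulr1 divff// scale1r.
  by rewrite scalerBl scale1r opprB addrA addrAC.
have fixT p : T p = p <-> Fix R p by apply: averaged_fixE; rewrite invr_eq0.
have dist0 p q : `|(k + 1) *: (p - q)| = scaled_dist (k + 1) p q.
  by rewrite normrZ gtr0_norm.
have distE p q : scaled_dist (k + 1) p q = `|(k + 1) *: p - (k + 1) *: q|.
  by rewrite -scalerBr dist0.
have distT p q : `|(k + 1) *: (p - q) + q - R q| = scaled_dist (k + 1) p (T q).
  by rewrite distE MT opprB scalerBr -!addrA (addrC (- _)) -addrA.
have gapT p : `|p - R p| = scaled_dist (k + 1) p (T p).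
  by rewrite distE MT subKr.
have distTT p q : `|k *: (p - q) + R p - R q| = scaled_dist (k + 1) (T p) (T q).
  have MT' r : (k + 1) *: T r = k *: r + R r.
    by rewrite MT scalerDl scale1r opprB addrA addrAC addrK.
  by rewrite distE !MT' scalerBr opprD addrACA addrA.
have contr : interpolative_contraction (scaled_dist (k + 1)) T a b c zeta.
  move=> p q /fixT hp /fixT hq.
  have := hT p q hp hq.
  by rewrite !gapT !distT distTT dist0.
have main p0 : exists s : G, Fix R s /\ iter m T p0 @[m --> \oo] --> s.
  have M1 : 1 <= k + 1 by lra.
  have [s [/fixT sT xs]] := interpolative_orbit_cvg p0 M1 a01 b0 c0 abc hz contr.
  by exists s.
split; first by have [s [Rs _]] := main 0; exists s.
(* The same [lambda] serves every starting point; it is at most 1 because [0 <= k]. *)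
move=> p0; exists (k + 1)^-1; split => //.
by rewrite invr_gt0 M0 invf_le1// lerDr.
Qed.
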